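(* There is an absolute constant $C>0$ such that for every $n$ and every $2$-edge-colouring of $K_n^{(3)}$ with no gadgets, there is a partition $[n]=X\cup Y$ such that, after changing the colour of at most $Cn^2$ edges, the following holds: all edges contained in $X$ and all edges contained in $Y$ have the same colour, and all edges intersecting both $X$ and $Y$ have the other colour.
   Context: $[n]=\{1,\dots,n\}$, and $K_n^{(3)}$ is the complete $3$-uniform hypergraph on $[n]$ (edges are all $3$-subsets of $[n]$). A $2$-edge-colouring assigns one of two colours to each edge, arbitrarily. In a partition $[n]=X\cup Y$ the sets are disjoint and one of them may be empty. Let $K^{(3)}_{2,2,2}$ be the complete $3$-partite $3$-uniform hypergraph with three parts of size $2$. With vertex set $\{1,\dots,6\}$ and parts $\{1,2\},\{3,4\},\{5,6\}$, its $8$ edges decompose (uniquely) into the two edge-disjoint Pasch configurations $\{135,146,236,245\}$ and $\{136,145,235,246\}$, where a Pasch configuration is a $3$-uniform hypergraph isomorphic to the one on $6$ vertices with edges $135,146,236,245$. In an edge-colouring of $K_n^{(3)}$, a gadget is a copy $K$ of $K^{(3)}_{2,2,2}$ in $K_n^{(3)}$ (as a subgraph) for which there is a colour $c$ such that the two Pasch configurations decomposing $K$ have a different number of edges of colour $c$. *)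

(* Defs.v *)
From mathcomp Require Import all_boot all_order all_algebra.
From mathcomp Require Import reals.

Set Implicit Arguments.
Unset Strict Implicit.
Unset Printing Implicit Defensive.

(* A hypergraph on V is identified with its edge set, a {set {set V}}. *)

Definition complete3 (V : finType) : {set {set V}} :=
  [set e : {set V} | #|e| == 3].

(* Copies are not induced, and vertices of V outside the image of f are
   ignored. *)
Definition is_copy (U V : finType) (H : {set {set U}}) (K : {set {set V}}) :
    Prop :=
  exists f : U -> V, injective f /\ K = [set f @: e | e : {set U} in H].

(* triple6 takes labels in {1, ..., 6}; the label k stands for k - 1 in 'I_6. *)
Definition triple6 (a b c : nat) : {set 'I_6} :=
  [set inord a.-1; inord b.-1; inord c.-1].

(* In these labels, the parts {1,2}, {3,4}, {5,6} are the classes of v %/ 2 on 'I_6. *)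
Definition K222 : {set {set 'I_6}} :=
  [set e : {set 'I_6} |
    [forall i : 'I_3, #|e :&: [set v : 'I_6 | v %/ 2 == i]| == 1]].

Definition pasch6 : {set {set 'I_6}} :=
  [set triple6 1 3 5; triple6 1 4 6; triple6 2 3 6; triple6 2 4 5].

Definition is_pasch (V : finType) (P : {set {set V}}) : Prop :=
  is_copy pasch6 P.

(* A colouring is a function on all subsets of V, of which only the values on
   the edges of complete3 V are ever used. *)
Definition colouring (V : finType) : Type := {set V} -> bool.

Definition ncol (V : finType) (chi : colouring V) (c : bool)
    (H : {set {set V}}) : nat :=
  #|[set e in H | chi e == c]|.

(* P and Q are quantified existentially, but they are determined by K up to
   exchanging them: the decomposition of K222 into two edge-disjoint Pasch
   configurations is unique. *)
Definition is_gadget (V : finType) (chi : colouring V) (K : {set {set V}}) :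
    Prop :=
  [/\ is_copy K222 K, K \subset complete3 V &
      exists P Q : {set {set V}},
        [/\ is_pasch P, is_pasch Q, P :|: Q = K, [disjoint P & Q] &
            exists c : bool, ncol chi c P <> ncol chi c Q]].

Definition changed_edges (V : finType) (chi chi' : colouring V) :
    {set {set V}} :=
  [set e in complete3 V | chi e != chi' e].

(* Main.v *)
Require Import Defs.
From mathcomp Require Import all_boot all_order all_algebra.
From mathcomp Require Import reals.
From mathcomp Require Import perm zify.
Import Order.TTheory GRing.Theory Num.Theory.
Local Open Scope ring_scope.

Set Implicit Arguments.
Unset Strict Implicit.

(** The absence of gadgets says that the 0/1 function [chi] on triples is
annihilated by every alternating sum over an octahedron, so off three fixed
vertices it is a sum of pair weights: for a symmetric integer function [H],
[H x y + H y z + H x z = 6 * chi {x, y, z}] ([pair_weight_sum]).  Everything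
else follows from this equation and from the fact that [chi] only takes the
values 0 and 1.

Compare two rows of [H].  The difference [d u = H x u - H y u] satisfies
[d u + d v \in {-6, 0, 6}] for all [u != v]; taking three vertices shows that
[3] divides [d u], hence all weights are congruent mod 3 ([weights_mod3]).
Modulo 2 the weights sum to zero on triangles, so the odd pairs form a cut
([parity_cut]); the two sides of this cut are the required parts.  If [x] and
[y] lie on the same side then [6] divides [d u], so at most one [d u] is
positive and at most one is negative: the rows of [x] and [y] are almost equal
([row_diff_small]).

By averaging, a matrix in which any two rows and any two columns almost agree
is constant up to linearly many entries ([rectangle_const]).  So, up to [O(n)]
pairs, [H] is a constant on each side and a constant [t] across the cut.  A
side which is not tiny contains a triangle all of whose weights equal its
constant [s], so [3 s] is [0] or [6] and [s = 2 c] with [c] a colour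
([weight_on_large_class]).  Two large sides have the same [c], by congruence
mod 3.  A mixed triangle has weights [s], [t], [t] with [t] odd and congruent
to [s] mod 3, so its sum is the other element of [{0, 6}], and it has the
other colour.  Each of the [O(n)] exceptional pairs is in at most [n] triples,
and so are the pairs that meet the bounded set of discarded vertices (the
reference vertices, and a side that is too small). *)

(** * The octahedron identity *)

Section OctahedronIdentity.
Local Open Scope nat_scope.

(** Reduces equality of subsets of the six labels to six membership bits, so
    that facts about [K222] and [pasch6] follow by checking 64 cases. *)
Lemma eq_set6 (e e' : {set 'I_6}) :
  (e == e') = all (fun k => (inord k \in e) == (inord k \in e')) (iota 0 6).
Proof.
apply/eqP/allP=> [-> //|h]; apply/setP=> i.
by rewrite -[i]inord_val; apply/eqP/h; rewrite mem_iota ltn_ord.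
Qed.

Lemma mem_triple6 a b c k :
  [&& a.-1 < 6, b.-1 < 6, c.-1 < 6 & k < 6] ->
  (inord k \in triple6 a b c) = [|| k == a.-1, k == b.-1 | k == c.-1].
Proof.
case/and4P=> ha hb hc hk; rewrite !inE -orbA.
by rewrite -!(inj_eq val_inj) /= !inordK.
Qed.

Lemma card_class6 (e : {set 'I_6}) (i : 'I_3) :
  #|e :&: [set v : 'I_6 | v %/ 2 == i]|
    = (inord i.*2 \in e) + (inord i.*2.+1 \in e).
Proof.
have lti := ltn_ord i.
have v0 : (inord i.*2 : 'I_6) = i.*2 :> nat by rewrite inordK //; lia.
have v1 : (inord i.*2.+1 : 'I_6) = i.*2.+1 :> nat by rewrite inordK //; lia.
have ne : (inord i.*2.+1 : 'I_6) != inord i.*2 by rewrite -val_eqE /= v0 v1; lia.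
rewrite (cardsD1 (inord i.*2)) (cardsD1 (inord i.*2.+1)) !inE ne v0 v1.
have -> : i.*2 %/ 2 == i by lia.
have -> : i.*2.+1 %/ 2 == i by lia.
rewrite !andbT /= addnA -[RHS]addn0; congr (_ + _); apply/eqP; rewrite cards_eq0.
apply/set0Pn=> -[v]; rewrite !inE -!val_eqE /= v0 v1; lia.
Qed.

(** The other Pasch configuration in the decomposition of [K222]. *)
Definition pasch6' : {set {set 'I_6}} :=
  [set triple6 1 3 6; triple6 1 4 5; triple6 2 3 5; triple6 2 4 6].

Lemma K222_setU : K222 = pasch6 :|: pasch6'.
Proof.
apply/setP=> e.
have -> : (e \in K222) = [&& (inord 0 \in e) + (inord 1 \in e) == 1,
    (inord 2 \in e) + (inord 3 \in e) == 1 &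
    (inord 4 \in e) + (inord 5 \in e) == 1].
  rewrite inE; apply/forallP/and3P=> [h|[h0 h1 h2] i].
    by split; [have := h ord0|have := h (inord 1)|have := h (inord 2)];
       rewrite card_class6 ?inordK.
  by rewrite card_class6; case: i => [[|[|[|//]]] hi].
rewrite !inE !eq_set6 /= !mem_triple6 //=.
by do 6!case: (_ \in e).
Qed.

Lemma pasch6'_swap :
  pasch6' = [set tperm (inord 4) (inord 5) @: e | e : {set 'I_6} in pasch6].
Proof.
rewrite !imsetU !imset_set1 /triple6 !imsetU !imset_set1 /=.
by rewrite tpermL tpermR !tpermD -?val_eqE /= ?inordK.
Qed.

Lemma cards3 (V : finType) (x y z : V) :
  x != y -> x != z -> y != z -> #|[set x; y; z]| = 3.
Proof.
by move=> xy xz yz; rewrite setUC cardsU1 cards2 xy !inE negb_or ![z == _]eq_sym xz yz.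
Qed.

Lemma K222_card e : e \in K222 -> #|e| = 3.
Proof.
rewrite K222_setU => /setUP[]; rewrite !inE -!orbA => /or4P[] /eqP->;
  by rewrite cards3 -?val_eqE /= ?inordK.
Qed.

Lemma imset_triple6 (V : finType) (f : 'I_6 -> V) a b c :
  f @: triple6 a b c = [set f (inord a.-1); f (inord b.-1); f (inord c.-1)].
Proof. by rewrite !imsetU !imset_set1. Qed.

Lemma ncol_imset4 (U V : finType) (chi : colouring V) c (f : U -> V)
    (e1 e2 e3 e4 : {set U}) :
  injective f -> uniq [:: e1; e2; e3; e4] ->
  ncol chi c [set f @: e | e : {set U} in [set e1; e2; e3; e4]]
  = (chi (f @: e1) == c) + (chi (f @: e2) == c) + (chi (f @: e3) == c)
    + (chi (f @: e4) == c).
Proof.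
move=> inj_f uniq_e.
rewrite /ncol -sum1dep_card big_mkcondr /= big_imset /=; last first.
  by move=> A B _ _; apply: imset_inj.
rewrite (eq_bigl (mem [:: e1; e2; e3; e4])); last by move=> e; rewrite !inE -!orbA.
by rewrite -big_uniq //= !big_cons big_nil addn0 !addnA.
Qed.

(** The two Pasch configurations of the octahedron with parts [{x, u}],
    [{y, v}], [{z, w}] have equally many edges of colour [true], as otherwise
    it would be a gadget. *)
Lemma octahedron_identity (V : finType) (chi : colouring V) (x y z u v w : V) :
  (forall K, ~ is_gadget chi K) -> uniq [:: x; u; y; v; z; w] ->
  chi [set x; y; z] + chi [set x; v; w] + chi [set u; y; w] + chi [set u; v; z]
  = chi [set x; y; w] + chi [set x; v; z] + chi [set u; y; z] + chi [set u; v; w].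
Proof.
move=> nog uniq_s; pose f (i : 'I_6) := nth x [:: x; u; y; v; z; w] i.
have inj_f : injective f.
  by move=> i j /eqP; rewrite nth_uniq // => /eqP/val_inj.
pose img (H : {set {set 'I_6}}) := [set f @: e | e : {set 'I_6} in H].
have img' : img pasch6' =
    [set (f \o tperm (inord 4) (inord 5)) @: e | e : {set 'I_6} in pasch6].
  rewrite /img pasch6'_swap -imset_comp; apply: eq_imset => e /=.
  by rewrite [RHS]imset_comp.
have eq_ncol : ncol chi true (img pasch6) = ncol chi true (img pasch6').
  apply/eqP/negPn/negP=> /eqP neq; apply: (nog (img K222)); split.
  - by exists f.
  - apply/subsetP=> _ /imsetP[e /K222_card e3 ->].
    by rewrite inE card_imset // e3.
  exists (img pasch6), (img pasch6'); split.
  - by exists f.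
  - exists (f \o tperm (inord 4) (inord 5)); split=> //.
    exact: inj_comp inj_f perm_inj.
  - by rewrite -imsetU -K222_setU.
  - rewrite imset_disjoint ?disjoints_subset; last exact: imset_inj.
    apply/subsetP=> e; rewrite !inE !eq_set6 /= !mem_triple6 //=.
    by do 6!case: (_ \in e).
  by exists true.
move: eq_ncol; rewrite /img !ncol_imset4 //; last 2 first.
- by rewrite /= !inE !eq_set6 /= !mem_triple6.
- by rewrite /= !inE !eq_set6 /= !mem_triple6.
rewrite !imset_triple6 /f /= !inordK //= !eqb_id => ->; lia.
Qed.
End OctahedronIdentity.

(** * Triples as sums of pair weights *)

(** If [chi {x, y, z} = g x y + g y z + g x z] on all triples, then [g x y] can
    be recovered from [chi] on the five points [x, y, u, v, w], because the
    inclusion matrix of pairs in triples of a 5-set is invertible; this is the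
    resulting formula for [6 * g x y]. *)
Definition pair_weight (V : finType) (chi : colouring V) (u v w x y : V) : int :=
  let f a b c : int := (chi [set a; b; c] : nat)%:Z in
  2 * (f x y u + f x y v + f x y w)
  - (f x u v + f x u w + f x v w)
  - (f y u v + f y u w + f y v w)
  + 2 * f u v w.

Lemma pair_weightC (V : finType) (chi : colouring V) u v w x y :
  pair_weight chi u v w x y = pair_weight chi u v w y x.
Proof. rewrite /pair_weight [[set x; y]]setUC; lia. Qed.

(** Sum the octahedron identity over the six ways of matching [x, y, z] with
    [u, v, w]. *)
Lemma pair_weight_sum (V : finType) (chi : colouring V) (u v w x y z : V) :
  (forall K, ~ is_gadget chi K) -> uniq [:: x; y; z; u; v; w] ->
  pair_weight chi u v w x y + pair_weight chi u v w y z + pair_weight chi u v w x z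
  = 6 * (chi [set x; y; z] : nat)%:Z.
Proof.
move=> nog uniq_s.
have F12 a b c : [set a; b; c] = [set b; a; c] :> {set V} by rewrite [[set a; b]]setUC.
have F23 a b c : [set a; b; c] = [set a; c; b] :> {set V} by rewrite setUAC.
have oct a b c : perm_eq [:: a; b; c] [:: u; v; w] ->
   (chi [set x; y; z] + chi [set x; b; c] + chi [set y; a; c] + chi [set z; a; b]
  = chi [set x; y; c] + chi [set x; z; b] + chi [set y; z; a] + chi [set a; b; c])%N.
  move=> p; rewrite (F23 x z b) (F12 y a c) (F23 y z a) (F12 y a z).
  rewrite (F12 z a b) (F23 a z b); apply: octahedron_identity => //.
  have: uniq ([:: x; y; z] ++ [:: a; b; c]).
    by rewrite (perm_uniq (s2 := [:: x; y; z] ++ [:: u; v; w])) // perm_cat2l.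
  rewrite (perm_uniq (s2 := [:: x; a; y; b; z; c])) //.
  by apply/seq.permP => P /=; lia.
have pe a b c : (forall P : pred V, P a + P b + P c = P u + P v + P w)%N ->
    perm_eq [:: a; b; c] [:: u; v; w].
  by move=> h; apply/seq.permP => P /=; have := h P; lia.
have := oct u v w (pe u v w (fun P => ltac:(lia))).
have := oct u w v (pe u w v (fun P => ltac:(lia))).
have := oct v u w (pe v u w (fun P => ltac:(lia))).
have := oct v w u (pe v w u (fun P => ltac:(lia))).
have := oct w u v (pe w u v (fun P => ltac:(lia))).
have := oct w v u (pe w v u (fun P => ltac:(lia))).
rewrite /pair_weight !(F23 _ w v) !(F23 _ v u) !(F23 _ w u).
rewrite !(F12 v u w) !(F12 w u v) !(F23 _ w v).
(* Opaque integers in place of the booleans keep the problem linear. *)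
have [k kE] : {k : {set V} -> nat | forall s, chi s = k s :> nat}.
  by exists (fun s => chi s : nat).
rewrite !kE; lia.
Qed.

(** * Averaging and counting *)

Section Counting.
Local Open Scope nat_scope.

Lemma card_set_sum (X : finType) (C : {set X}) (P : pred X) :
  #|[set y in C | P y]| = \sum_(y in C) P y.
Proof. by rewrite -sum1dep_card big_mkcondr. Qed.

Lemma sum_setX (T U : finType) (A : {set T}) (B : {set U}) (F : T * U -> nat) :
  \sum_(q in setX A B) F q = \sum_(x in A) \sum_(y in B) F (x, y).
Proof.
rewrite pair_big /=; apply: eq_big => [[x y]|[x y] _] //=.
by rewrite in_setX.
Qed.

(** Pick as [s] the entry at [(x1, y1)], where row [x1] has few entries different
    from the one in column [y1]; such a position exists by averaging, since
    the columns are close to each other.  All rows are close to row [x1]. *)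
Lemma rectangle_const (T U : finType) (R : eqType) (s0 : R) (A : {set T})
    (B : {set U}) (M : T -> U -> R) (c : nat) :
  (forall x x', x \in A -> x' \in A ->
     #|[set y in B | M x y != M x' y]| <= c) ->
  (forall y y', y \in B -> y' \in B ->
     #|[set x in A | M x y != M x y']| <= c) ->
  exists s, #|[set q in setX A B | M q.1 q.2 != s]| <= c * (#|A| + #|B|).
Proof.
move=> rows cols; pose m x y' := #|[set y in B | M x y != M x y']|.
have [AB0|AB_gt0] := posnP (#|A| * #|B|).
  exists s0; rewrite (@leq_trans 0) // -AB0 -cardsX subset_leq_card //.
  by apply/subsetP=> q; rewrite inE => /andP[].
case: (pickP [pred q | (q \in setX A B) && (#|A| * m q.1 q.2 <= c * #|B|)]).
  move=> [x1 y1] /= /andP[/setXP[/= x1A y1B] small]; exists (M x1 y1).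
  rewrite card_set_sum sum_setX.
  have row x : x \in A -> \sum_(y in B) (M x y != M x1 y1) <= c + m x1 y1.
    move=> xA; apply: leq_trans (leq_add (rows x x1 xA x1A) (leqnn _)).
    rewrite /m !card_set_sum -big_split leq_sum //= => y _.
    by case: eqP => //; do 2![case: eqP => //] => -> ->.
  apply: leq_trans (leq_sum _ row) _; rewrite sum_nat_const !mulnDr mulnC.
  by rewrite leq_add2l.
move=> none.
have large : \sum_(q in setX A B) (c * #|B|).+1
             <= \sum_(q in setX A B) #|A| * m q.1 q.2.
  by apply: leq_sum => q qAB; have := none q; rewrite /= qAB ltnNge => /negbT.
have small : \sum_(q in setX A B) m q.1 q.2 <= #|B| * (#|B| * c).
  rewrite sum_setX /= exchange_big -sum_nat_const leq_sum // => y' y'B.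
  rewrite -sum_nat_const (eq_bigr _ (fun x _ => card_set_sum _ _)) exchange_big.
  by apply: leq_sum => y yB; rewrite -card_set_sum cols.
move: large; rewrite -big_distrr sum_nat_const cardsX /= => large.
have := leq_trans large (leq_mul (leqnn #|A|) small).
suff -> : #|A| * (#|B| * (#|B| * c)) = #|A| * #|B| * (c * #|B|).
  by rewrite leq_pmul2l // ltnn.
by rewrite [c * _]mulnC mulnA.
Qed.

(** At most [3 * 9 * #|Z| ^ 2] of the [#|Z| ^ 3] ordered triples in [Z] contain
    a pair of [E] or a repetition, and [27 < 28]. *)
Lemma pairs_avoid_triple (V : finType) (Z : {set V}) (E : {set V * V}) :
  #|E| <= 8 * #|Z| -> 28 <= #|Z| ->
  exists x y z, [/\ [/\ x \in Z, y \in Z & z \in Z],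
    [/\ x != y, y != z & x != z] &
    [/\ (x, y) \notin E, (y, z) \notin E & (x, z) \notin E]].
Proof.
move=> E_small Z_large.
pose E' := E :|: [set (x, x) | x in Z].
have E'_small : #|E'| <= 9 * #|Z|.
  rewrite (leq_trans (leq_card_setU _ _)) // mulSn addnC leq_add ?leq_imset_card //.
pose T := setX (setX Z Z) Z.
pose good (t : V * V * V) :=
  [&& (t.1.1, t.1.2) \notin E', (t.1.2, t.2) \notin E' & (t.1.1, t.2) \notin E'].
case: (pickP [pred t | (t \in T) && good t]) => [[[x y] z]|none].
  rewrite /= !in_setX /= /good /= -!andbA => /and5P[xZ yZ zZ xyE /andP[yzE xzE]].
  move: xyE yzE xzE.
  rewrite !in_setU !negb_or => /andP[xyE xy] /andP[yzE yz] /andP[xzE xz].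
  exists x, y, z; split; split=> //.
  - by apply: contraNneq xy => <-; apply: imset_f.
  - by apply: contraNneq yz => <-; apply: imset_f.
  - by apply: contraNneq xz => <-; apply: imset_f.
have cover : T \subset
   [set (t.1.1, t.1.2, t.2) | t : V * V * V in setX E' Z] :|:
   ([set (t.2, t.1.1, t.1.2) | t : V * V * V in setX E' Z] :|:
    [set (t.1.1, t.2, t.1.2) | t : V * V * V in setX E' Z]).
  apply/subsetP=> -[[x y] z] xyzT.
  have := none (x, y, z); rewrite /= xyzT /good /= => /negbT.
  move: xyzT; rewrite !in_setX -andbA => /and3P[xZ yZ zZ].
  rewrite !negb_and !negbK => hit; rewrite !in_setU; apply/or3P.
  case/or3P: hit => hit.
  - by apply: Or31; apply/imsetP; exists (x, y, z); rewrite // in_setX hit.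
  - by apply: Or32; apply/imsetP; exists (y, z, x); rewrite // in_setX hit.
  - by apply: Or33; apply/imsetP; exists (x, z, y); rewrite // in_setX hit.
have := subset_leq_card cover; rewrite leqNgt => /negP[].
apply: (@leq_ltn_trans (3 * (9 * #|Z| * #|Z|))); last first.
  by rewrite !cardsX; nia.
have part (f : V * V * V -> V * V * V) : #|f @: setX E' Z| <= 9 * #|Z| * #|Z|.
  by rewrite (leq_trans (leq_imset_card _ _)) // cardsX leq_mul.
rewrite (leq_trans (leq_card_setU _ _)) // mulSn leq_add //.
by rewrite (leq_trans (leq_card_setU _ _)) // mul2n -addnn leq_add.
Qed.

Lemma card3P (V : finType) (d : {set V}) : #|d| = 3 ->
  exists x y z, [/\ x != y, y != z, x != z & d = [set x; y; z]].
Proof.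
move=> d3; have /card_gt2P[x [y [z [[xd yd zd] [xy yz zx]]]]] : 2 < #|d| by rewrite d3.
exists x, y, z; rewrite eq_sym in zx; split=> //; apply/eqP.
rewrite eq_sym eqEcard d3 cards3 // leqnn andbT.
by apply/subsetP=> v; rewrite !inE -orbA => /or3P[] /eqP->.
Qed.

(** Every member of [D] is obtained from a pair in [E] by adding a vertex. *)
Lemma card_covered_triples (V : finType) (E : {set V * V}) (D : {set {set V}}) :
  D \subset complete3 V ->
  (forall x y z, x != y -> y != z -> x != z ->
     (forall a b, a \in [set x; y; z] -> b \in [set x; y; z] -> a != b ->
        (a, b) \notin E) ->
     [set x; y; z] \notin D) ->
  #|D| <= #|E| * #|V|.
Proof.
move=> D3 goodND; rewrite -[#|V|]cardsT -cardsX.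
apply: leq_trans (leq_imset_card (fun t => [set t.1.1; t.1.2; t.2]) _).
apply/subset_leq_card/subsetP=> d dD.
have := subsetP D3 d dD; rewrite inE => /eqP d3.
have [x [y [z [xy yz xz def_d]]]] := card3P d3.
case: (boolP [exists a in d, exists b in d, (a != b) && ((a, b) \in E)]).
  move=> /exists_inP[a ad /exists_inP[b bd /andP[ab abE]]].
  move: d3; rewrite (cardsD1 a) ad (cardsD1 b) !inE eq_sym ab bd => -[] /eqP/cards1P[c def_c].
  apply/imsetP; exists (a, b, c); first by rewrite in_setX abE inE.
  apply/setP=> v; have /setP/(_ v) := def_c; rewrite !inE /=.
  have [->|_] := eqVneq v a; first by rewrite ad.
  by have [->|_] := eqVneq v b; first by rewrite bd.
rewrite def_d in dD *; move/existsPn=> noE; have := goodND x y z xy yz xz.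
rewrite dD => /(_ _)/negP[] // a b ad bd ab; have := noE a.
by rewrite ad /= => /existsPn/(_ b); rewrite bd ab.
Qed.
End Counting.

(** * Integer weights with all triangle sums 0 or 6 *)

Definition block_target (V : finType) (X : {set V}) (c : bool) : colouring V :=
  fun e => if (e \subset X) || (e \subset ~: X) then c else ~~ c.

Section TriangleSums.

Variables (V : finType) (chi : colouring V) (H : V -> V -> int) (W : {set V}).
Hypothesis HC : forall x y, H x y = H y x.
Hypothesis Hsum : forall x y z, x \in W -> y \in W -> z \in W ->
  x != y -> y != z -> x != z ->
  H x y + H y z + H x z = 6 * (chi [set x; y; z] : nat)%:Z.
Hypothesis W5 : (5 <= #|W|)%N.

Lemma exists_pair_away (x y u : V) : exists v w,
  [/\ v \in W, w \in W, v != w & [/\ v != x, v != y, v != u & [/\ w != x, w != y & w != u]]].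
Proof.
have : (1 < #|W :\: [set x; y; u]|)%N.
  have := cardsID [set x; y; u] W; have := subset_leq_card (subsetIr W [set x; y; u]).
  have := (leq_card_setU [set x; y] [set u]).1; rewrite cards2 cards1; lia.
case/card_gt1P=> v [w [vW wW vw]]; exists v, w.
by move: vW wW; rewrite !inE !negb_or -!andbA => /and4P[-> -> -> ->] /and4P[-> -> -> ->].
Qed.

(** With [d = H x _ - H y _], and [v], [w] two more vertices,
    [2 * d u = (d u + d v) + (d u + d w) - (d v + d w)] is a multiple of 6. *)
Lemma row_diff_mod3 (x y u : V) : x \in W -> y \in W -> u \in W ->
  x != y -> u != x -> u != y -> exists k : int, H x u - H y u = 3 * k.
Proof.
move=> xW yW uW xy ux uy.
have [v [w [vW wW vw [vx vy vu [wx wy wu]]]]] := exists_pair_away x y u.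
have xu : x != u by rewrite eq_sym.
have yu : y != u by rewrite eq_sym.
have xv : x != v by rewrite eq_sym.
have yv : y != v by rewrite eq_sym.
have xw : x != w by rewrite eq_sym.
have yw : y != w by rewrite eq_sym.
have uv : u != v by rewrite eq_sym.
have uw : u != w by rewrite eq_sym.
have := Hsum xW uW vW xu uv xv; have := Hsum yW uW vW yu uv yv.
have := Hsum xW uW wW xu uw xw; have := Hsum yW uW wW yu uw yw.
have := Hsum xW vW wW xv vw xw; have := Hsum yW vW wW yv vw yw.
have [f fE] : {f : {set V} -> int | forall e, (chi e : nat)%:Z = f e}.
  by exists (fun e => (chi e : nat)%:Z).
rewrite !fE => e1 e2 e3 e4 e5 e6.
exists (f [set x; u; v] + f [set x; u; w] - f [set x; v; w]
        - f [set y; u; v] - f [set y; u; w] + f [set y; v; w]).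
by clear -e1 e2 e3 e4 e5 e6; lia.
Qed.

Lemma weights_mod3 (x y z w : V) : x \in W -> y \in W -> z \in W -> w \in W ->
  x != y -> z != w -> exists k : int, H x y - H z w = 3 * k.
Proof.
have step a b c : a \in W -> b \in W -> c \in W -> a != c -> b != c ->
    exists k : int, H a c - H b c = 3 * k.
  move=> aW bW cW ac bc; have [->|ab] := eqVneq a b; first by exists 0; lia.
  by apply: row_diff_mod3 => //; rewrite eq_sym.
move=> xW yW zW wW xy zw; have [yz|yz] := eqVneq y z.
  have wy : w != y by rewrite yz eq_sym.
  have [k ek] := step x w y xW wW yW xy wy.
  by exists k; rewrite -ek -yz (HC y w).
have zy : z != y by rewrite eq_sym.
have wz : w != z by rewrite eq_sym.
have [k ek] := step x z y xW zW yW xy zy; have [l el] := step y w z yW wW zW yz wz.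
by exists (k + l); rewrite mulrDr -ek -el (HC z y) (HC z w); lia.
Qed.

Variable x0 : V.
Hypothesis x0W : x0 \in W.
Let W' := W :\ x0.
Let p x := odd `|H x0 x|%N.

(** The three weights of the triangle [x0, x, y] have an even sum. *)
Lemma parity_cut x y : x \in W' -> y \in W' -> x != y ->
  odd `|H x y|%N = p x (+) p y.
Proof.
move=> /setD1P[xx0 xW] /setD1P[yx0 yW] xy; rewrite ![_ == x0]eq_sym in xx0 yx0.
have := Hsum x0W xW yW xx0 xy yx0; rewrite /p; lia.
Qed.

(** Off [x] and [y] the row differences are multiples of 6 and any two of them
    add up to at most 6 in absolute value, so each sign occurs at most once. *)
Lemma row_diff_small x y : x \in W' -> y \in W' -> p x = p y ->
  (#|[set u in W' | H x u != H y u]| <= 4)%N.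
Proof.
move=> xW' yW' pxy; have [->|xy] := eqVneq x y.
  by rewrite (_ : [set _ in _ | _] = set0) ?cards0 //; apply/setP=> u; rewrite !inE eqxx andbF.
have /setD1P[_ xW] := xW'; have /setD1P[_ yW] := yW'.
pose S (P : pred int) := [set u in W' :\ x :\ y | P (H x u - H y u)].
have row6 u : u \in W' :\ x :\ y -> exists k : int, H x u - H y u = 6 * k.
  move=> /setD1P[uy /setD1P[ux uW']]; have /setD1P[_ uW] := uW'.
  have [k ek] := row_diff_mod3 xW yW uW xy ux uy.
  have := parity_cut uW' xW' ux; have := parity_cut uW' yW' uy.
  rewrite pxy !(HC u) => <- odd_eq; exists (k %/ 2)%Z.
  by move: (H x u) (H y u) ek odd_eq => a c; clear; lia.
have gap u v : u \in W' :\ x :\ y -> v \in W' :\ x :\ y -> u != v ->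
    -6 <= (H x u - H y u) + (H x v - H y v) <= 6.
  move=> /setD1P[uy /setD1P[ux /setD1P[_ uW]]] /setD1P[vy /setD1P[vx /setD1P[_ vW]]] uv.
  rewrite eq_sym in uy; rewrite eq_sym in ux; rewrite eq_sym in vy; rewrite eq_sym in vx.
  have := Hsum xW uW vW ux uv vx; have := Hsum yW uW vW uy uv vy.
  by case: (chi _); case: (chi _); clear; lia.
have one_sign (P : pred int) :
    (forall k l : int, P (6 * k) -> P (6 * l) -> ~~ (-6 <= 6 * k + 6 * l <= 6)) ->
    (#|S P| <= 1)%N.
  move=> same_sign; apply/card_le1_eqP => u v /setIdP[uW Pu] /setIdP[vW Pv].
  apply/eqP/negPn/negP=> uv; have := gap v u vW uW uv; apply/negP.
  have [k ek] := row6 u uW; have [l el] := row6 v vW.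
  by rewrite ek in Pu *; rewrite el in Pv *; apply: same_sign.
have pos : (#|S (fun d => (0 < d)%R)| <= 1)%N by apply: one_sign => k l /=; clear; lia.
have neg : (#|S (fun d => (d < 0)%R)| <= 1)%N by apply: one_sign => k l /=; clear; lia.
have cover : [set u in W' | H x u != H y u] \subset
    [set x; y] :|: (S (fun d => (0 < d)%R) :|: S (fun d => (d < 0)%R)).
  apply/subsetP=> u; rewrite !inE => /andP[-> neq].
  case: (eqVneq u x) => //= _; case: (eqVneq u y) => //= _.
  by move: (H x u) (H y u) neq; clear; lia.
apply: leq_trans (subset_leq_card cover) _.
have := (leq_card_setU [set x; y] (S (fun d => (0 < d)%R) :|: S (fun d => (d < 0)%R))).1.
have := (leq_card_setU (S (fun d => (0 < d)%R)) (S (fun d => (d < 0)%R))).1.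
rewrite cards2; lia.
Qed.

Let cls (b : bool) := [set x in W' | p x == b].

Lemma clsP b x : x \in cls b -> x \in W' /\ p x = b.
Proof. by rewrite inE => /andP[xW /eqP]. Qed.

Lemma weight_on_block b b' : exists s,
  (#|[set q in setX (cls b) (cls b') | H q.1 q.2 != s]| <= 4 * (#|cls b| + #|cls b'|))%N.
Proof.
have row a x y : x \in cls a -> y \in cls a -> forall a',
    (#|[set u in cls a' | H x u != H y u]| <= 4)%N.
  move=> /clsP[xW px] /clsP[yW py] a'; rewrite -py in px.
  apply: leq_trans (row_diff_small xW yW px); apply: subset_leq_card.
  by apply/subsetP=> u; rewrite !inE => /andP[/andP[-> _] ->].
apply: (rectangle_const 0) => x y xC yC; first exact: row xC yC _.
have := row b' x y xC yC b; congr (_ <= _)%N; apply: eq_card => u.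
by rewrite !inE (HC x) (HC y).
Qed.

(** A triangle inside the class with all three weights equal to the constant [s]
    gives [3 * s = 6 * c], where [c] is its colour. *)
Lemma weight_on_large_class b : (28 <= #|cls b|)%N -> exists c : bool,
  (#|[set q in setX (cls b) (cls b) | H q.1 q.2 != (2 * (c : nat)%:Z)%R]|
     <= 8 * #|cls b|)%N /\
  exists x y, [/\ x \in W, y \in W, x != y & H x y = 2 * (c : nat)%:Z].
Proof.
move=> large; have [s] := weight_on_block b b; rewrite addnn -mul2n mulnA => few.
have [x [y [z [[xC yC zC] [xy yz xz]]]]] := pairs_avoid_triple few large.
have off u v : u \in cls b -> v \in cls b ->
    (u, v) \notin [set q in setX (cls b) (cls b) | H q.1 q.2 != s] -> H u v = s.
  by move=> uC vC; rewrite in_set in_setX /= uC vC negbK => /eqP.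
move=> -[/(off _ _ xC yC) exy /(off _ _ yC zC) eyz /(off _ _ xC zC) exz].
have W'W v : v \in cls b -> v \in W by move=> /clsP[/setD1P[]].
have := Hsum (W'W _ xC) (W'W _ yC) (W'W _ zC) xy yz xz.
rewrite exy eyz exz => sum_s; exists (chi [set x; y; z]).
have <- : s = 2 * (chi [set x; y; z] : nat)%:Z.
  by move: (chi _) sum_s => f; clear; lia.
by split=> //; exists x, y; split=> //; apply: W'W.
Qed.

(** [E] consists of the exceptional pairs for [H] and of all pairs meeting a
    discarded vertex; a triple without such a pair has the three weights predicted
    by the position of its vertices relative to the cut. *)
Lemma block_colouring : (60 <= #|V|)%N -> (#|V| <= #|W'| + 4)%N ->
  exists (X : {set V}) (c : bool) (E : {set V * V}), (#|E| <= 39 * #|V|)%N /\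
    forall x y z, x != y -> y != z -> x != z ->
      (forall a b, a \in [set x; y; z] -> b \in [set x; y; z] -> a != b ->
         (a, b) \notin E) ->
      chi [set x; y; z] = block_target X c [set x; y; z].
Proof.
move=> V60 W'V.
have W'cls b : #|W'| = (#|cls b| + #|cls (~~ b)|)%N.
  rewrite -(cardsID (cls b) W'); congr (_ + _)%N; apply: eq_card => v; rewrite !inE.
    by case: (v != x0); case: (v \in W); case: (p v == b).
  by case: (v != x0); case: (v \in W); case: (p v); case: b.
have Vcls b : (#|V| <= #|cls b| + #|cls (~~ b)| + 4)%N by rewrite -W'cls.
have clsV b : (#|cls b| + #|cls (~~ b)| <= #|V|)%N by rewrite -W'cls max_card.
have [b large] : exists b, (28 <= #|cls b|)%N.
  have [large|small] := leqP 28 #|cls true|; first by exists true.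
  exists false; move: (Vcls true) small V60 => /=.
  by clear; lia.
have [c [few [x1 [y1 [x1W y1W xy1 e1]]]]] := weight_on_large_class large.
set B := [set q in _ | _] in few.
have out (U : {set V}) (E : {set V * V}) x y : setX (~: U) [set: V] \subset E ->
    (x, y) \notin E -> x \in U.
  move=> sub; apply: contraR => xU; apply: (subsetP sub).
  by rewrite !inE xU.
have good (b1 b2 : bool) s (E : {set V * V}) x y :
    [set q in setX (cls b1) (cls b2) | H q.1 q.2 != s] \subset E ->
    (x, y) \notin E -> x \in cls b1 -> y \in cls b2 -> H x y = s.
  move=> sub xyE xC yC; apply/eqP; apply: contraR xyE => ne; apply: (subsetP sub).
  by rewrite in_set in_setX /= xC yC.
have W'W v : v \in W' -> v \in W by move=> /setD1P[].
have in3 (x y z : V) : [/\ x \in [set x; y; z], y \in [set x; y; z] & z \in [set x; y; z]].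
  by rewrite !inE !eqxx !orbT.
(* A class of at most 27 vertices is discarded, along with the at most 4
   vertices outside both classes: hence 39 = 27 + 4 + 8. *)
have [large'|small] := leqP 28 #|cls (~~ b)|; last first.
  exists set0, c, (setX (~: cls b) [set: V] :|: B); split.
    apply: leq_trans (leq_card_setU _ _) _; rewrite cardsX cardsT.
    have rest : (#|~: cls b| <= 31)%N.
      by move: (cardsC (cls b)) (Vcls b) small; clear; lia.
    rewrite (mulnDl 31 8) leq_add ?leq_mul2r ?rest ?orbT //.
    by rewrite (leq_trans few) // leq_mul2l max_card.
  move=> x y z xy yz xz noE; have [xe ye ze] := in3 x y z.
  have xC : x \in cls b by apply: out (noE x y xe ye xy); apply: subsetUl.
  have yC : y \in cls b by apply: out (noE y z ye ze yz); apply: subsetUl.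
  have zC : z \in cls b.
    by apply: out (noE z x ze xe _); [apply: subsetUl|rewrite eq_sym].
  have exy := good _ _ _ _ _ _ (subsetUr _ _) (noE x y xe ye xy) xC yC.
  have eyz := good _ _ _ _ _ _ (subsetUr _ _) (noE y z ye ze yz) yC zC.
  have exz := good _ _ _ _ _ _ (subsetUr _ _) (noE x z xe ze xz) xC zC.
  have [xW yW zW] := And3 (clsP xC).1 (clsP yC).1 (clsP zC).1.
  have := Hsum (W'W _ xW) (W'W _ yW) (W'W _ zW) xy yz xz; rewrite exy eyz exz.
  rewrite /block_target setC0 subsetT orbT.
  by move: (chi _) => f; clear; case: f; case: c; lia.
have [c' [few' [x2 [y2 [x2W y2W xy2 e2]]]]] := weight_on_large_class large'.
have cc' : c' = c.
  have [k] := weights_mod3 x1W y1W x2W y2W xy1 xy2; rewrite e1 e2.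
  by clear; case: c; case: c' => //=; lia.
rewrite {}cc' {c'} in few' e2.
set B' := [set q in _ | _] in few'.
have [t] := weight_on_block b (~~ b); set B'' := [set q in _ | _] => few''.
pose E := setX (~: W') [set: V] :|: (B :|: (B' :|: B'')).
exists (cls b), c, E; split.
  have rest : (#|~: W'| * #|V| <= 4 * #|V|)%N.
    by rewrite leq_mul2r; apply/orP; right; move: (cardsC W') W'V; clear; lia.
  rewrite -cardsT -cardsX in rest.
  apply: leq_trans (leq_card_setU _ _) _; apply: leq_trans (leq_add rest _) _.
    apply: leq_trans (leq_card_setU _ _) _; apply: leq_add few _.
    by apply: leq_trans (leq_card_setU _ _) _; apply: leq_add few' few''.
  by rewrite cardsT; move: (clsV b); clear; lia.
move=> x y z xy yz xz noE; have [xe ye ze] := in3 x y z.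
have xW : x \in W' by apply: out (noE x y xe ye xy); apply: subsetUl.
have yW : y \in W' by apply: out (noE y z ye ze yz); apply: subsetUl.
have zW : z \in W'.
  by apply: out (noE z x ze xe _); [apply: subsetUl|rewrite eq_sym].
have inC v d : v \in W' -> p v = d -> v \in cls d by move=> vW <-; rewrite inE vW eqxx.
have BE : B \subset E by rewrite /E setUCA subsetUl.
have B'E : B' \subset E by rewrite /E setUC -!setUA setUCA subsetUl.
have B''E : B'' \subset E by rewrite /E !setUA subsetUr.
(* Across the cut [H u v - 2 * c = 3 * k] is odd, so [k] is odd. *)
have value u v : u \in [set x; y; z] -> v \in [set x; y; z] -> u != v ->
    u \in W' -> v \in W' ->
    exists k : int, [/\ H u v = 2 * (c : nat)%:Z + 3 * k,
       p u = p v -> k = 0 & p u != p v -> H u v = t /\ odd `|k|%N].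
  move=> ue ve uv uW vW; have [k ek] := weights_mod3 (W'W _ uW) (W'W _ vW) x1W y1W uv xy1.
  exists k; have eH : H u v = 2 * (c : nat)%:Z + 3 * k by rewrite -ek e1 addrC subrK.
  have vu : v != u by rewrite eq_sym.
  have uvE := noE _ _ ue ve uv; have vuE := noE _ _ ve ue vu.
  have par := parity_cut uW vW uv.
  have pNb d : d != b -> d = ~~ b by case: d; case: (b).
  have same s : s = 2 * (c : nat)%:Z -> H u v = s -> k = 0.
    by move=> -> eHs; move: ek; rewrite e1 eHs; clear; lia.
  have diff : p u != p v -> odd `|k|%N.
    move: ek par; rewrite e1; case: (p u); case: (p v) => //; clear; case: c; lia.
  split=> // puv.
    have [pu|/pNb pu] := eqVneq (p u) b; have pv := etrans (esym puv) pu.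
      exact: same (good _ _ _ _ _ _ BE uvE (inC _ _ uW pu) (inC _ _ vW pv)).
    exact: same (good _ _ _ _ _ _ B'E uvE (inC _ _ uW pu) (inC _ _ vW pv)).
  split; last exact: diff.
  have [pu|/pNb pu] := eqVneq (p u) b.
    have pv : p v = ~~ b by apply: pNb; rewrite -pu eq_sym.
    exact: good _ _ _ _ _ _ B''E uvE (inC _ _ uW pu) (inC _ _ vW pv).
  have pv : p v = b by move: puv; rewrite pu; case: (p v); case: (b).
  by rewrite HC; apply: good B''E vuE (inC _ _ vW pv) (inC _ _ uW pu).
have [k1 [exy sxy dxy]] := value _ _ xe ye xy xW yW.
have [k2 [eyz syz dyz]] := value _ _ ye ze yz yW zW.
have [k3 [exz sxz dxz]] := value _ _ xe ze xz xW zW.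
have := Hsum (W'W _ xW) (W'W _ yW) (W'W _ zW) xy yz xz.
have in_cls v : v \in W' -> (v \in cls b) = (p v == b) by move=> vW; rewrite in_set vW.
rewrite /block_target !subUset !sub1set !in_setC !in_cls //.
move: exy sxy dxy eyz syz dyz exz sxz dxz.
move: (p x) (p y) (p z) (H x y) (H y z) (H x z) (chi _) => px py pz hxy hyz hxz f.
clear; case: px; case: py; case: pz => /= exy sxy dxy eyz syz dyz exz sxz dxz.
all: try have {}sxy := sxy erefl; try have {dxy}[dxy oxy] := dxy isT;
     try have {}syz := syz erefl; try have {dyz}[dyz oyz] := dyz isT;
     try have {}sxz := sxz erefl; try have {dxz}[dxz oxz] := dxz isT;
     by case: b; case: f; case: c exy eyz exz => //= exy eyz exz; lia.
Qed.

End TriangleSums.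

(** * The partition *)

(** With fewer than 60 vertices there are at most [60 * #|V| ^ 2] triples, so the
    bound is trivial; otherwise one of the two classes has at least 28 vertices,
    as [2 * 27 + 4 < 60]. *)
Lemma close_to_block_colouring (V : finType) (chi : colouring V) :
  (forall K, ~ is_gadget chi K) -> exists (X : {set V}) (c : bool),
    (#|changed_edges chi (block_target X c)| <= 60 * #|V| ^ 2)%N.
Proof.
move=> nog.
have changed3 chi' : changed_edges chi chi' \subset complete3 V.
  by apply/subsetP=> e /setIdP[].
have [large|small] := leqP 60 #|V|; last first.
  exists set0, true.
  have cover := card_covered_triples (E := [set: V * V]) (changed3 (block_target set0 true)).
  apply: leq_trans (cover _) _.
    move=> x y z xy _ _ noE; have := noE x y; rewrite !inE !eqxx orbT.
    by move=> /(_ isT isT xy).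
  by rewrite cardsT card_prod mulnC -mulnn leq_mul2r ltnW ?orbT.
have /card_gt2P[u [v [w [_ [uv vw wu]]]]] : (2 < #|[set: V]|)%N.
  by rewrite cardsT (leq_trans _ large).
pose W := ~: [set u; v; w].
have W_card : (#|W| + 3 = #|V|)%N.
  by rewrite -(cardsC [set u; v; w]) cards3 1?addnC // eq_sym.
have [x0 x0W] : exists x0, x0 \in W.
  by apply/card_gt0P; move: W_card large; clear; lia.
have distinct x y z : x \in W -> y \in W -> z \in W -> x != y -> y != z -> x != z ->
    uniq [:: x; y; z; u; v; w].
  rewrite /W !inE !negb_or -!andbA => /and3P[xu xv xw] /and3P[yu yv yw].
  move=> /and3P[zu zv zw] xy yz xz; rewrite /= !inE !negb_or.
  by rewrite xy xz xu xv xw yz yu yv yw zu zv zw uv vw eq_sym wu.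
have [|||X [c [E [E_card goodE]]]] := block_colouring (chi := chi)
    (H := pair_weight chi u v w) (pair_weightC chi u v w) _ _ x0W large.
- by move=> x y z xW yW zW xy yz xz; apply: pair_weight_sum; last exact: distinct.
- by move: W_card large; clear; lia.
- by move: W_card; rewrite (cardsD1 x0 W) x0W; clear; lia.
exists X, c; apply: leq_trans (card_covered_triples (changed3 _) _) _; last first.
  rewrite -mulnn mulnA leq_mul2r; apply/orP; right.
  by apply: leq_trans E_card _; rewrite leq_mul2r orbT.
move=> x y z xy yz xz /(goodE x y z xy yz xz) e.
by rewrite inE e eqxx andbF.
Qed.

Theorem proposition3p2 (R : realType) :
  exists C : R, 0 < C /\
    forall (n : nat) (chi : colouring 'I_n),
      (forall K : {set {set 'I_n}}, ~ is_gadget chi K) ->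
      exists X Y : {set 'I_n},
        [/\ X :|: Y = [set: 'I_n], [disjoint X & Y] &
          exists chi' : colouring 'I_n,
            #|changed_edges chi chi'|%:R <= C * n%:R ^+ 2 /\
            exists c : bool,
              [/\ forall e : {set 'I_n}, e \in complete3 'I_n -> e \subset X -> chi' e = c,
                  forall e : {set 'I_n}, e \in complete3 'I_n -> e \subset Y -> chi' e = c &
                  forall e : {set 'I_n}, e \in complete3 'I_n ->
                    e :&: X != set0 -> e :&: Y != set0 -> chi' e = ~~ c]].
Proof.
exists 60; split=> // n chi nog.
have [X [c few]] := close_to_block_colouring nog.
exists X, (~: X); split; [exact: setUCr | by rewrite -setI_eq0 setICr |].
exists (block_target X c); split.
  by rewrite -natrX -natrM ler_nat; rewrite card_ord in few.
exists c; split=> e _; rewrite /block_target; [by move=> -> | by move=> ->; rewrite orbT|].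
case/set0Pn=> x /setIP[xe xX] /set0Pn[y /setIP[ye yX]].
case: ifP => // /orP[] /subsetP sub; last by have := sub x xe; rewrite inE xX.
by have := sub y ye; rewrite inE in yX; rewrite (negPf yX).
Qed.
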